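(* (1) The ring automorphisms $T'_i$ ($i\in I$) of $\mathcal{Y}'$ defined below satisfy the braid relations of $\mathfrak{g}$, hence generate an action of the braid group of $\mathfrak{g}$ on $\mathcal{Y}'$. (2) For every $i\in I$, the restriction of $T'_i$ to $\mathcal{Y}\subset\mathcal{Y}'$ is the Chari operator $T_i$.
   Context: Notation: $\mathfrak{g}$ simple finite-dimensional over $\mathbb{C}$, index set $I$, Cartan matrix $C$, symmetrizers $d_i$, weight lattice $P$ with fundamental weights $\omega_i$, simple roots $\alpha_i=\sum_jC_{j,i}\omega_j$, Weyl group $W$ acting on $P$ by $s_k(\omega_j)=\omega_j-\delta_{kj}\alpha_j$. Fix $q\in\mathbb{C}^\times$ not a root of unity with a chosen logarithm, $q_i=q^{d_i}$. An $\ell$-weight is an $I$-tuple $(\Psi_i(z))_{i\in I}$ of formal power series with $\Psi_i(0)\in q^{\mathbb{Q}}$; they form a group under componentwise multiplication. Let $\mathbf{\Psi}_{i,a}$ be the $\ell$-weight with $j$-th component $(1-za)^{\delta_{i,j}}$, and for $\lambda=\sum_jr_j\omega_j\in P$ let $[\lambda]$ be the constant $\ell$-weight with $j$-th component $q_j^{r_j}$. Let $\mathcal{Y}'=\mathbb{Z}[\mathbf{\Psi}_{i,a}^{\pm1},[\omega_j]^{\pm1}]_{i,j\in I,a\in\mathbb{C}^\times}$ (the group ring of the subgroup of $\ell$-weights they generate). The ring $\mathcal{Y}=\mathbb{Z}[Y_{i,a}^{\pm1}]$ embeds in $\mathcal{Y}'$ via $Y_{i,a}\mapsto[\omega_i]\mathbf{\Psi}_{i,aq_i^{-1}}\mathbf{\Psi}_{i,aq_i}^{-1}$.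 Put $A_{i,a}=Y_{i,aq_i^{-1}}Y_{i,aq_i}\big(\prod_{C_{j,i}=-1}Y_{j,a}\prod_{C_{j,i}=-2}Y_{j,aq^{-1}}Y_{j,aq}\prod_{C_{j,i}=-3}Y_{j,aq^{-2}}Y_{j,a}Y_{j,aq^2}\big)^{-1}$; the Chari operator $T_i$ is the ring automorphism of $\mathcal{Y}$ with $T_i(Y_{i,a})=Y_{i,a}A_{i,aq_i}^{-1}$, $T_i(Y_{j,a})=Y_{j,a}$ ($j\neq i$). Define ring automorphisms $T'_i$ of $\mathcal{Y}'$ by $T'_i([\omega])=[s_i(\omega)]$ for $\omega\in P$, $T'_i(\mathbf{\Psi}_{j,a})=\mathbf{\Psi}_{j,a}$ for $j\ne i$, and $$T'_i(\mathbf{\Psi}_{i,a})=\mathbf{\Psi}_{i,aq_i^2}^{-1}\prod_{j:C_{i,j}=-1}\mathbf{\Psi}_{j,aq_i}\prod_{j:C_{i,j}=-2}\mathbf{\Psi}_{j,a}\mathbf{\Psi}_{j,aq^2}\prod_{j:C_{i,j}=-3}\mathbf{\Psi}_{j,aq^{-1}}\mathbf{\Psi}_{j,aq}\mathbf{\Psi}_{j,aq^3}.$$ *)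

(* Defs.v *)
From mathcomp Require Import all_boot all_order all_algebra.
From mathcomp Require Import Rstruct complex freeg.
Set Implicit Arguments.
Unset Strict Implicit.
Unset Printing Implicit Defensive.
Import GRing.Theory Num.Theory.
Local Open Scope ring_scope.

Definition CC := (Rdefinitions.R)[i].
Definition Cx := {a : CC | a != 0}.

Lemma Cx_shift_neq0 (a q : Cx) (k : int) : val a * val q ^ k != 0.
Proof. rewrite mulf_neq0 //; first by case: a. by rewrite expfz_neq0 //; case: q. Qed.

(* sh q a k = a q^k  (spectral shift) *)
Definition sh (q a : Cx) (k : int) : Cx := exist (fun z : CC => z != 0) _ (Cx_shift_neq0 a q k).

Definition not_root_of_unity (q : Cx) := forall n : nat, (0 < n)%N -> val q ^+ n != 1.

(* Convention: alpha_i = sum_j C j i omega_j, d_i C_{ij} = d_j C_{ji},  *)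
(* d_i >= 1 and min d_i = 1 (short roots have d = 1).                  *)
Definition simple_cartan_datum (I : finType) (C : I -> I -> int) (d : I -> nat) :=
  [/\ (0 < #|I|)%N,
      (forall i, C i i = 2) /\ (forall i j, i != j -> C i j <= 0),
      [/\ (forall i, (0 < d i)%N), (exists i, d i = 1%N) &
          (forall i j, (d i)%:Z * C i j = (d j)%:Z * C j i)],
      (forall S : {set I}, S != set0 -> S != setT ->
         exists i j, [/\ i \in S, j \notin S & C i j != 0])
    &
      (forall x : I -> int, (exists i, x i != 0) ->
         0 < \sum_i \sum_j x i * (d i)%:Z * C i j * x j)].

Definition braid_m (I : finType) (C : I -> I -> int) (i j : I) : nat :=
  match (C i j * C j i)%R with
  | Posz 0 => 2%N | Posz 1 => 3%N | Posz 2 => 4%N | _ => 6%N end.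

Fixpoint alt_word (I : Type) (X : Type) (f : I -> X -> X) (i j : I) (n : nat) : X -> X :=
  match n with 0 => id | n'.+1 => f i \o alt_word f j i n' end.

(* A free abelian group on keys K is {freeg K / int} (written additively).
   Its group ring Z[{freeg K / int}] is  GR K := {freeg {freeg K / int} / int},
   a monomial m being << m >>.                                         *)
Definition GR (K : choiceType) := {freeg {freeg K / int} / int}.

Definition mono (K : choiceType) (m : {freeg K / int}) : GR K := << m >>.

Definition gr_one (K : choiceType) : GR K := << 0 >>.
Definition gr_mul (K : choiceType) (x y : GR K) : GR K :=
  fglift (fun m1 : {freeg K / int} =>
            fglift (fun m2 : {freeg K / int} => << (m1 + m2) >> : GR K) y) x.

Definition gr_map (K K' : choiceType) (phi : {freeg K / int} -> {freeg K' / int})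
  (x : GR K) : GR K' := fglift (fun m => << phi m >> : GR K') x.

Definition fg_hom (K K' : choiceType) (g : K -> {freeg K' / int})
  : {freeg K / int} -> {freeg K' / int} := fglift g.

Definition ring_automorphism (K : choiceType) (T : GR K -> GR K) :=
  [/\ {morph T : x y / x + y}, {morph T : x y / gr_mul x y},
      T (gr_one K) = gr_one K & bijective T].

Section Data.
Variables (I : finType) (C : I -> I -> int) (d : I -> nat) (q : Cx).

(* generators of the group of l-weights considered:
   inl (i, a) = Psi_{i,a},  inr j = [omega_j] *)
Definition Kp := ((I * Cx) + I)%type.
Definition Yp := GR Kp.

Definition Psi (i : I) (a : Cx) : {freeg Kp / int} := << inl (i, a) >>.
Definition omega (j : I) : {freeg Kp / int} := << inr j >>.
Definition wt (r : I -> int) : {freeg Kp / int} := \sum_j r j *: omega j.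

(* Weyl group action on P (coordinates in the fundamental weights):
   s_k(lambda) = lambda - lambda_k alpha_k,  alpha_k = sum_j C j k omega_j *)
Definition sref (k : I) (r : I -> int) : I -> int := fun j => r j - r k * C j k.
Definition fund (j : I) : I -> int := fun k => (j == k)%:R.

Definition Tp_gen (i : I) (x : Kp) : {freeg Kp / int} :=
  match x with
  | inl (j, a) =>
      if j == i then
        - Psi i (sh q a (2 * (d i)%:Z))
        + \sum_(j' | C i j' == -1) Psi j' (sh q a (d i)%:Z)
        + \sum_(j' | C i j' == -2) (Psi j' a + Psi j' (sh q a 2))
        + \sum_(j' | C i j' == -3)
             (Psi j' (sh q a (-1)) + Psi j' (sh q a 1) + Psi j' (sh q a 3))
      else Psi j a
  | inr j => wt (sref i (fund j))
  end.

Definition Tp (i : I) : Yp -> Yp := gr_map (fg_hom (Tp_gen i)).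

Definition Ky := (I * Cx)%type.
Definition Yr := GR Ky.
Definition Yv (i : I) (a : Cx) : {freeg Ky / int} := << (i, a) >>.

Definition Avar (i : I) (a : Cx) : {freeg Ky / int} :=
  Yv i (sh q a (- (d i)%:Z)) + Yv i (sh q a (d i)%:Z)
  - ( \sum_(j | C j i == -1) Yv j a
    + \sum_(j | C j i == -2) (Yv j (sh q a (-1)) + Yv j (sh q a 1))
    + \sum_(j | C j i == -3) (Yv j (sh q a (-2)) + Yv j a + Yv j (sh q a 2))).

Definition Tc_gen (i : I) (x : Ky) : {freeg Ky / int} :=
  let: (j, a) := x in
  if j == i then Yv i a - Avar i (sh q a (d i)%:Z) else Yv j a.

Definition Tc (i : I) : Yr -> Yr := gr_map (fg_hom (Tc_gen i)).

Definition emb_gen (x : Ky) : {freeg Kp / int} :=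
  let: (i, a) := x in
  omega i + Psi i (sh q a (- (d i)%:Z)) - Psi i (sh q a (d i)%:Z).

Definition emb : Yr -> Yp := gr_map (fg_hom emb_gen).

End Data.

(* Main.v *)
From HB Require Import structures.
Require Import Defs.
From mathcomp Require Import all_boot all_order all_algebra.
From mathcomp Require Import Rstruct complex freeg.
From mathcomp Require Import zify ring.
Import Order.TTheory GRing.Theory Num.Theory.
Local Open Scope ring_scope.

Set Implicit Arguments.
Unset Strict Implicit.

(** Each [T'_i] is induced by an additive endomorphism of the lattice of
    monomials, so everything is checked on generators. There [T'_i] is a
    deformed reflection: it moves only the [Psi_{i,a}] and [omega_i], by
    increments [w_{i,a}] with [T'_i w_{i,a} = - w_{i,a q_i^2}], while
    [T'_j w_{i,a} - w_{i,a}] is a sum of shifts of [w_j] depending only on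
    [C_{ij}]. Hence a braid relation is a computation in the span of the [w_i]
    and [w_j], in which the other nodes play no part. The shifts match for
    [C_{ij} = -2] and [C_{ij} = -3] only because [d_i = 1] in these cases; this
    follows from positive definiteness and connectedness: a diagram with two
    multiple edges carries a nonzero vector of nonpositive norm. *)

(** * Group rings and the maps induced by maps of monomials *)

(** Reduces identities to generators, on the monomial lattice as well as on [GR K], itself free on
    monomials. Bare functions are allowed, so that composites and partial products need no
    bundling. *)
Lemma freeg_morph_ext (K : choiceType) (V : zmodType)
    (f g : {freeg K / int} -> V) :
  {morph f : x y / x - y} -> {morph g : x y / x - y} ->
  (forall k, f << k >> = g << k >>) -> f =1 g.
Proof.
move=> fB gB fg x.
pose fM := GRing.isZmodMorphism.Build _ _ f fB.
pose gM := GRing.isZmodMorphism.Build _ _ g gB.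
pose fA : {additive _ -> _} := HB.pack f fM.
pose gA : {additive _ -> _} := HB.pack g gM.
rewrite -[x]freeg_sumE -[f _]/(fA _) -[g _]/(gA _) !raddf_sum.
apply: eq_bigr => z _; rewrite -[coeff z x]intz -freegU_mulz !raddfMz.
by rewrite /= fg.
Qed.

HB.instance Definition _ (K K' : choiceType) (g : K -> {freeg K' / int}) :=
  GRing.isZmodMorphism.Build _ _ (fg_hom g) (lift_is_additive g).

HB.instance Definition _ (K K' : choiceType)
    (phi : {freeg K / int} -> {freeg K' / int}) :=
  GRing.isZmodMorphism.Build (GR K) (GR K') (gr_map phi)
    (lift_is_additive (fun m => << phi m >> : GR K')).

Lemma fg_homU (K K' : choiceType) (g : K -> {freeg K' / int}) k :
  fg_hom g << k >> = g k.
Proof. by rewrite /fg_hom liftU scale1r. Qed.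

Lemma gr_mapU (K K' : choiceType) (phi : {freeg K / int} -> {freeg K' / int}) m :
  gr_map phi << m >> = << phi m >>.
Proof. by rewrite /gr_map liftU scale1r. Qed.

Lemma gr_map_id (K : choiceType) : @gr_map K K id =1 id.
Proof. by apply: freeg_morph_ext => // [x y|m]; rewrite ?raddfB ?gr_mapU. Qed.

Lemma gr_map_comp (K1 K2 K3 : choiceType)
    (f : {freeg K2 / int} -> {freeg K3 / int})
    (g : {freeg K1 / int} -> {freeg K2 / int}) :
  gr_map f \o gr_map g =1 gr_map (f \o g).
Proof.
by apply: freeg_morph_ext => [x y|x y|m] /=; rewrite ?raddfB ?gr_mapU.
Qed.

Lemma eq_gr_map (K K' : choiceType) (f g : {freeg K / int} -> {freeg K' / int}) :
  f =1 g -> gr_map f =1 gr_map g.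
Proof.
by move=> fg; apply: freeg_morph_ext => [x y|x y|m]; rewrite ?raddfB ?gr_mapU ?fg.
Qed.

Lemma gr_mulU (K : choiceType) (m n : {freeg K / int}) :
  gr_mul << m >> << n >> = << m + n >> :> GR K.
Proof. by rewrite /gr_mul !liftU !scale1r. Qed.

Lemma gr_mulBl (K : choiceType) (z : GR K) :
  {morph (fun x => gr_mul x z) : x y / x - y}.
Proof. exact: lift_is_additive. Qed.

(** The product is a lift in its left factor, so additivity on the right is seen only once the left
    factor is reduced to a monomial. *)
Lemma gr_mulBr (K : choiceType) (z : GR K) : {morph gr_mul z : x y / x - y}.
Proof.
move=> x y; move: z; apply: freeg_morph_ext => [z z'|z z'|m].
- by rewrite gr_mulBl.
- by rewrite !gr_mulBl !opprD !opprK addrACA.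
- by rewrite /gr_mul !liftU !scale1r lift_is_additive.
Qed.

Lemma gr_map_mul (K K' : choiceType) (f : {additive {freeg K / int} -> {freeg K' / int}}) :
  {morph gr_map f : x y / gr_mul x y}.
Proof.
move=> x y; move: x; apply: freeg_morph_ext => [x x'|x x'|m].
- by rewrite gr_mulBl raddfB.
- by rewrite raddfB gr_mulBl.
- move: y; apply: freeg_morph_ext => [y y'|y y'|n].
  + by rewrite gr_mulBr raddfB.
  + by rewrite raddfB gr_mulBr.
  + by rewrite gr_mulU !gr_mapU gr_mulU raddfD.
Qed.

Lemma gr_map_automorphism (K : choiceType)
    (f : {additive {freeg K / int} -> {freeg K / int}}) :
  bijective f -> ring_automorphism (gr_map f).
Proof.
move=> [g fK gK]; split; first exact: raddfD.
- exact: gr_map_mul.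
- by rewrite gr_mapU raddf0.
- exists (gr_map g) => x.
    by have /= -> := gr_map_comp g f x; rewrite (eq_gr_map fK) gr_map_id.
  by have /= -> := gr_map_comp f g x; rewrite (eq_gr_map gK) gr_map_id.
Qed.

(** Moves a braid word from the group ring down to the monomial lattice. *)
Lemma alt_word_gr_map (K : choiceType) (I : Type)
    (f : I -> {freeg K / int} -> {freeg K / int}) i j n :
  alt_word (fun i => gr_map (f i)) i j n =1 gr_map (alt_word f i j n).
Proof.
elim: n i j => [|n IHn] i j x /=; first by rewrite gr_map_id.
by rewrite IHn; have /= -> := gr_map_comp (f i) (alt_word f j i n) x.
Qed.

Lemma alt_word_subr (V : zmodType) (I : Type) (f : I -> {additive V -> V}) i j n :
  {morph alt_word f i j n : x y / x - y}.
Proof. by elim: n i j => [|n IHn] i j x y //=; rewrite IHn raddfB. Qed.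

Lemma alt_word_fix (V I : Type) (f : I -> V -> V) i j n v :
  f i v = v -> f j v = v -> alt_word f i j n v = v.
Proof. by elim: n i j => [|n IHn] i j //= fi fj; rewrite IHn. Qed.

Ltac abelian := apply/eqP/freeg_eqP => ?; rewrite !(coeffD, coeffN); ring.

(** * Braid words of two abstract deformed reflections *)

Section BraidRelation.
Variables (K : choiceType) (S T : {additive {freeg K / int} -> {freeg K / int}}).
Variables (x y : int -> {freeg K / int}).
Local Notation V := {freeg K / int}.
Implicit Types u v : V.

Lemma braid2 u v :
  T u = u -> S v = v + u -> T v = v -> S (T v) = T (S v).
Proof. by move=> Tu Sv Tv; rewrite Tv Sv raddfD Tv Tu. Qed.

(** The families [x] and [y] stand for the increments of the two nodes, indexed by the exponent of
    the spectral shift. As [T] fixes [v], the relation says that [S] fixes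
    [T (S v) = v + x 0 + y a]: the two terms in [x (2 * a)] cancel. *)
Lemma braid3 (a : int) v :
  (forall k, S (x k) = - x (k + 2 * a)) ->
  (forall k, T (x k) = x k + y (k + a)) ->
  (forall k, S (y k) = y k + x (k + a)) ->
  (forall k, T (y k) = - y (k + 2 * a)) ->
  S v = v + x 0 -> T v = v -> S (T (S v)) = T (S (T v)).
Proof.
move=> Sx Tx Sy Ty Sv Tv; rewrite !(Sv, Tv, raddfD, Sx, Tx, Sy, raddfN) /=.
by rewrite (_ : 0 + a + a = 0 + 2 * a); [abelian|ring].
Qed.

Section Doubled.
Hypotheses (Sx : forall k, S (x k) = - x (k + 2))
  (Tx : forall k, T (x k) = x k + (y k + y (k + 2)))
  (Sy : forall k, S (y k) = y k + x (k + 2))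
  (Ty : forall k, T (y k) = - y (k + 4)).

(** As [T] fixes [v], the left side is [S (T (S v))], and the claim is that [T] fixes this vector.
    The three lemmas that follow use the same reduction. *)
Lemma braid4l v : S v = v + x 0 -> T v = v ->
  S (T (S (T v))) = T (S (T (S v))).
Proof.
move=> Sv Tv.
have Sx0 : S (x 0) = - x 2 := Sx 0.
have Tx0 : T (x 0) = x 0 + (y 0 + y 2) := Tx 0.
have Tx4 : T (x 4) = x 4 + (y 4 + y 6) := Tx 4.
have Sy0 : S (y 0) = y 0 + x 2 := Sy 0.
have Sy2 : S (y 2) = y 2 + x 4 := Sy 2.
have Ty0 : T (y 0) = - y 4 := Ty 0.
have Ty2 : T (y 2) = - y 6 := Ty 2.
have E : S (T (S v)) = v + x 0 + x 4 + y 0 + y 2.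
  by rewrite !(Sv, Tv, raddfD, raddfN, Sx0, Tx0, Sy0, Sy2) /=; abelian.
by rewrite Tv E !(raddfD, Tv, Tx0, Tx4, Ty0, Ty2) /=; abelian.
Qed.

Lemma braid4r v : S v = v -> T v = v + y 0 ->
  S (T (S (T v))) = T (S (T (S v))).
Proof.
move=> Sv Tv.
have Sy0 : S (y 0) = y 0 + x 2 := Sy 0.
have Tx2 : T (x 2) = x 2 + (y 2 + y 4) := Tx 2.
have Sx2 : S (x 2) = - x 4 := Sx 2.
have Ty0 : T (y 0) = - y 4 := Ty 0.
have Sy2 : S (y 2) = y 2 + x 4 := Sy 2.
have E : T (S (T v)) = v + y 0 + y 2 + x 2.
  by rewrite !(Sv, Tv, raddfD, raddfN, Sy0, Tx2, Ty0) /=; abelian.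
by rewrite Sv E !(raddfD, Sv, Sy0, Sy2, Sx2) /=; abelian.
Qed.
End Doubled.

Section Tripled.
Hypotheses (Sx : forall k, S (x k) = - x (k + 2))
  (Tx : forall k, T (x k) = x k + (y (k - 1) + y (k + 1) + y (k + 3)))
  (Sy : forall k, S (y k) = y k + x (k + 3))
  (Ty : forall k, T (y k) = - y (k + 6)).

(** The five-letter word is built one letter at a time in [E1] to [E4]; [T] fixes the last vector
    because the increments of its [x] terms cancel the changes of its [y] terms. *)
Lemma braid6l v : S v = v + x 0 -> T v = v ->
  S (T (S (T (S (T v))))) = T (S (T (S (T (S v))))).
Proof.
move=> Sv Tv.
have E1 : T (S v) = v + x 0 + y (-1) + y 1 + y 3.
  by rewrite Sv raddfD Tv (Tx 0 : _ = x 0 + (y (-1) + y 1 + y 3)); abelian.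
have E2 : S (T (S v)) = v + x 0 + y (-1) + y 1 + y 3 + x 4 + x 6.
  rewrite E1 !(raddfD, Sv) /= (Sx 0 : _ = - x 2) (Sy (-1) : _ = y (-1) + x 2).
  rewrite (Sy 1 : _ = y 1 + x 4) (Sy 3 : _ = y 3 + x 6); abelian.
have E3 : T (S (T (S v))) =
    v + x 0 + x 4 + x 6 + y (-1) + y 1 + y 3 + y 3 + y 5 + y 7.
  rewrite E2 !(raddfD, Tv) /= (Tx 0 : _ = x 0 + (y (-1) + y 1 + y 3)).
  rewrite (Tx 4 : _ = x 4 + (y 3 + y 5 + y 7)) (Tx 6 : _ = x 6 + (y 5 + y 7 + y 9)).
  rewrite (Ty (-1) : _ = - y 5) (Ty 1 : _ = - y 7) (Ty 3 : _ = - y 9); abelian.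
have E4 : S (T (S (T (S v)))) =
    v + x 0 + x 4 + x 6 + x 10 + y (-1) + y 1 + y 3 + y 3 + y 5 + y 7.
  rewrite E3 !(raddfD, Sv) /= (Sx 0 : _ = - x 2) (Sx 4 : _ = - x 6).
  rewrite (Sx 6 : _ = - x 8) (Sy (-1) : _ = y (-1) + x 2).
  rewrite (Sy 1 : _ = y 1 + x 4) (Sy 3 : _ = y 3 + x 6).
  rewrite (Sy 5 : _ = y 5 + x 8) (Sy 7 : _ = y 7 + x 10); abelian.
rewrite Tv E4 !(raddfD, Tv) /= (Tx 0 : _ = x 0 + (y (-1) + y 1 + y 3)).
rewrite (Tx 4 : _ = x 4 + (y 3 + y 5 + y 7)) (Tx 6 : _ = x 6 + (y 5 + y 7 + y 9)).
rewrite (Tx 10 : _ = x 10 + (y 9 + y 11 + y 13)).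
rewrite (Ty (-1) : _ = - y 5) (Ty 1 : _ = - y 7) (Ty 3 : _ = - y 9).
rewrite (Ty 5 : _ = - y 11) (Ty 7 : _ = - y 13); abelian.
Qed.

Lemma braid6r v : S v = v -> T v = v + y 0 ->
  S (T (S (T (S (T v))))) = T (S (T (S (T (S v))))).
Proof.
move=> Sv Tv.
have E1 : S (T v) = v + y 0 + x 3.
  by rewrite Tv raddfD Sv (Sy 0 : _ = y 0 + x 3); abelian.
have E2 : T (S (T v)) = v + y 0 + x 3 + y 2 + y 4.
  rewrite E1 !(raddfD, Tv) /= (Ty 0 : _ = - y 6).
  rewrite (Tx 3 : _ = x 3 + (y 2 + y 4 + y 6)); abelian.
have E3 : S (T (S (T v))) = v + y 0 + y 2 + y 4 + x 3 + x 7.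
  rewrite E2 !(raddfD, Sv) /= (Sy 0 : _ = y 0 + x 3) (Sx 3 : _ = - x 5).
  rewrite (Sy 2 : _ = y 2 + x 5) (Sy 4 : _ = y 4 + x 7); abelian.
have E4 : T (S (T (S (T v)))) = v + y 0 + y 2 + y 4 + x 3 + x 7 + y 6.
  rewrite E3 !(raddfD, Tv) /= (Ty 0 : _ = - y 6) (Ty 2 : _ = - y 8).
  rewrite (Ty 4 : _ = - y 10) (Tx 3 : _ = x 3 + (y 2 + y 4 + y 6)).
  rewrite (Tx 7 : _ = x 7 + (y 6 + y 8 + y 10)); abelian.
rewrite Sv E4 !(raddfD, Sv) /= (Sy 0 : _ = y 0 + x 3) (Sy 2 : _ = y 2 + x 5).
rewrite (Sy 4 : _ = y 4 + x 7) (Sy 6 : _ = y 6 + x 9).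
rewrite (Sx 3 : _ = - x 5) (Sx 7 : _ = - x 9); abelian.
Qed.
End Tripled.
End BraidRelation.

Lemma additive_scale_int (U W : lmodType int) (f : {additive U -> W}) (n : int) u :
  f (n *: u) = n *: f u.
Proof. by rewrite -[n]intz !scaler_int raddfMz. Qed.

(** * Rank-two classification from positive definiteness and connectedness *)

Section CartanDatum.
Variables (I : finType) (C : I -> I -> int) (d : I -> nat).
Hypothesis cartan : simple_cartan_datum C d.

Let dC i j : int := (d i)%:Z * C i j.
Let quad (x : I -> int) : int := \sum_i \sum_j x i * dC i j * x j.
Let ind (S : {set I}) (i : I) : int := (i \in S)%:R.

Lemma cartan_diag i : C i i = 2.
Proof. by case: cartan => _ []. Qed.

Lemma cartan_le0 i j : i != j -> C i j <= 0.
Proof. by case: cartan => _ [_ +] _ _ _; apply. Qed.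

Lemma symmetrizer_gt0 i : (0 < d i)%N.
Proof. by case: cartan => _ _ [+ _ _] _ _; apply. Qed.

Lemma cartan_symmetrizable i j : (d i)%:Z * C i j = (d j)%:Z * C j i.
Proof. by case: cartan => _ _ [_ _ +] _ _; apply. Qed.

Let dC_le0 i j : i != j -> dC i j <= 0.
Proof. by move=> /cartan_le0 ?; rewrite /dC; nia. Qed.

Let quad_gt0 x i : x i != 0 -> 0 < quad x.
Proof.
case: cartan => _ _ _ _ pos xi; have := pos x (ex_intro _ i xi).
congr (0 < _); apply: eq_bigr => k _; apply: eq_bigr => l _.
by rewrite /dC !mulrA.
Qed.

(** Symmetry of [dC] merges the two cross terms. All test vectors below are built by changing one
    coordinate at a time. *)
Let quad_addpt x c w :
  quad (fun i => x i + c * (i == w)%:R) =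
  quad x + 2 * c * (\sum_j dC w j * x j) + c ^+ 2 * dC w w.
Proof.
have pick (F : I -> int) : \sum_j F j * (j == w)%:R = F w.
  rewrite (bigD1 w) //= eqxx mulr1 big1 ?addr0 // => j /negPf ->.
  by rewrite mulr0.
rewrite /quad.
transitivity (\sum_i (x i * (\sum_j dC i j * x j) + c * (dC w i * x i)
   + (c * (\sum_j dC i j * x j) + c ^+ 2 * dC i w) * (i == w)%:R)).
  apply: eq_bigr => i _.
  transitivity ((x i + c * (i == w)%:R) *
    (\sum_j dC i j * x j + c * \sum_j dC i j * (j == w)%:R)).
    rewrite mulr_sumr -big_split mulr_sumr /=; apply: eq_bigr => j _; ring.
  rewrite pick (_ : dC w i = dC i w); last by rewrite /dC cartan_symmetrizable.
  by case: (i == w) => /=; ring.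
rewrite !big_split /= pick -mulr_sumr.
under eq_bigr do rewrite mulr_sumr.
under [in RHS]eq_bigr do under eq_bigr do rewrite -mulrA.
by ring.
Qed.

Let quad0 : quad (fun=> 0) = 0.
Proof. by rewrite /quad big1 // => i _; rewrite big1 // => j _; rewrite mulr0. Qed.

Let eq_quad x y : x =1 y -> quad x = quad y.
Proof. by move=> e; apply: eq_bigr => i _; apply: eq_bigr => j _; rewrite !e. Qed.

Let quadZ c x : quad (fun i => c * x i) = c ^+ 2 * quad x.
Proof.
rewrite /quad mulr_sumr; apply: eq_bigr => i _.
by rewrite mulr_sumr; apply: eq_bigr => j _; ring.
Qed.

(** Off-diagonal entries are nonpositive, so dropping every neighbour of [w] except [v] only
    increases the sum. *)
Let dC_sum_le (x : I -> int) w v : v != w -> x w = 0 -> (forall j, 0 <= x j) ->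
  \sum_j dC w j * x j <= dC w v * x v.
Proof.
move=> vw xw x0; rewrite (bigD1 v) //= -[leRHS]addr0 lerD2l.
apply: sumr_le0 => j _; have [->|jw] := eqVneq j w; first by rewrite xw mulr0.
by rewrite mulr_le0_ge0 ?x0 // dC_le0 // eq_sym.
Qed.

Let cartan_prod i j : i != j -> C i j * C j i < 4.
Proof.
move=> ij; have ji : (j == i) = false by rewrite eq_sym (negPf ij).
(* The vector [2 e_i - C j i e_j] is orthogonal to [e_j] and has norm
   [2 d_i (4 - C i j * C j i)]. *)
pose x k : int := 0 + 2 * (k == i)%:R.
pose y k : int := x k - C j i * (k == j)%:R.
have : 0 < quad y.
  by apply: (@quad_gt0 _ i); rewrite /y /x eqxx (negPf ij) mulr0 subr0.
rewrite (@eq_quad y (fun k => x k + (- C j i) * (k == j)%:R)); last first.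
  by move=> k; rewrite /y mulNr.
rewrite quad_addpt quad_addpt quad0 (_ : \sum_k dC i k * 0 = 0); last first.
  by rewrite big1 // => k _; rewrite mulr0.
rewrite (bigD1 i) //= big1 => [|k ki]; last first.
  by rewrite /x (negPf ki) !mulr0.
rewrite /x eqxx /dC !cartan_diag.
move=> h; have s := cartan_symmetrizable i j; have := symmetrizer_gt0 i => di.
have {}h : 0 < (d i)%:Z * (4 - C i j * C j i).
  rewrite mulrBr [_ * (C i j * _)]mulrA s.
  by move: h => /=; rewrite mulr1n; nia.
by nia.
Qed.

Let cartan_eq0 i j : C i j = 0 -> C j i = 0.
Proof.
move=> e; have := cartan_symmetrizable i j; have := symmetrizer_gt0 j.
by rewrite e; nia.
Qed.

(** Two nonzero entries with product below 4 cannot both be less than -1; symmetrizability then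
    gives the ratio of [d i] and [d j], but not yet their values. *)
Let cartan_cases_sym i j : i != j ->
  [\/ C i j = 0 /\ C j i = 0,
      [/\ C i j = -1, C j i = -1 & d i = d j],
      [/\ C i j = -1, C j i < -1, - 4 < C j i & (d i)%:Z = - C j i * (d j)%:Z] |
      [/\ C i j < -1, - 4 < C i j, C j i = -1 & (d j)%:Z = - C i j * (d i)%:Z]].
Proof.
move=> ij; have ji : j != i by rewrite eq_sym.
have l1 := cartan_le0 ij; have l2 := cartan_le0 ji.
have pr := cartan_prod ij; have s := cartan_symmetrizable i j.
have [e|n] := eqVneq (C i j) 0; first by apply: Or41; split=> //; apply: cartan_eq0.
have n' : C j i != 0 by apply: contra n => /eqP/cartan_eq0 ->.
have := symmetrizer_gt0 i; have := symmetrizer_gt0 j => dj di.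
have [e|ne] := eqVneq (C i j) (-1).
  have [e'|ne'] := eqVneq (C j i) (-1).
    by apply: Or42; split=> //; move: s; rewrite e e'; lia.
  by apply: Or43; split=> //; move: s pr; rewrite e; lia.
have [e'|ne'] := eqVneq (C j i) (-1).
  by apply: Or44; split=> //; move: s pr; rewrite e'; lia.
by exfalso; nia.
Qed.

(** What the norm estimates need: [dC i j] is at most minus the larger of the two symmetrizers, and
    unequal ones differ by a factor of at least 2. *)
Let adj_jump i j : i != j -> C i j != 0 ->
  [\/ (d i = d j) /\ dC i j <= - (d i)%:Z,
      (d i)%:Z >= 2 * (d j)%:Z /\ dC i j <= - (d i)%:Z |
      (d j)%:Z >= 2 * (d i)%:Z /\ dC i j <= - (d j)%:Z].
Proof.
move=> ij; rewrite /dC.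
case: (cartan_cases_sym ij) => [[-> _]|[-> e e']|[-> h1 h2 h3]|[h1 h2 h3 h4]] //.
- by move=> _; apply: Or31; lia.
- by move=> _; apply: Or32; nia.
- by move=> _; apply: Or33; nia.
Qed.

(* If a connected set S of nodes with the same d had two neighbours u, w with
   other values of d, then the vector equal to 2 on S, and to 1 or 2 at u and w
   according to whether d increases or decreases there, would have nonpositive
   norm. *)
Let unique_jump i j : i != j -> C j i != 0 -> d j != d i ->
  exists S : {set I}, [/\ i \in S, forall v, v \in S -> d v = d i &
    forall u v, u \notin S -> v \in S -> C u v != 0 -> u = j].
Proof.
move=> ij Cji dji.
have ind_addpt (S : {set I}) u : u \notin S ->
    ind (u |: S) =1 (fun k => ind S k + 1 * (k == u)%:R).
  move=> uS k; rewrite /ind !inE; have [->|ku] /= := eqVneq k u.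
    by rewrite (negPf uS) mulr1 add0r.
  by rewrite mulr0 addr0.
(* The bound on the norm replaces connectedness of [S]; a maximal such set is taken. *)
pose flat (S : {set I}) := [&& i \in S, [forall v in S, d v == d i] &
   quad (ind S) <= 2 * (d i)%:Z].
have flat1 : flat [set i].
  rewrite /flat inE eqxx /=; apply/andP; split.
    by apply/forall_inP => v; rewrite inE => /eqP ->.
  rewrite (@eq_quad _ (fun k => 0 + 1 * (k == i)%:R)); last first.
    by move=> k; rewrite /ind inE add0r mul1r.
  rewrite quad_addpt quad0 big1 => [|k _]; last by rewrite mulr0.
  by rewrite /dC cartan_diag; lia.
have [S /maxsetP[/and3P[iS /forall_inP dS qS] maxS] _] := maxset_exists flat1.
have {}dS v : v \in S -> d v = d i by move=> /dS/eqP.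
exists S; split=> //.
have neq_out u v : u \notin S -> v \in S -> v != u.
  by move=> uS vS; apply: contraNneq uS => <-.
(* Adding a neighbour with the same [d] changes the norm by at most [- 2 d_i + 2 d_i = 0], against
   maximality. *)
have boundary u v : u \notin S -> v \in S -> C u v != 0 -> d u != d i.
  move=> uS vS Cuv; apply/eqP => du.
  have : flat (u |: S).
    rewrite /flat !inE iS orbT /=; apply/andP; split.
      by apply/forall_inP => k; rewrite !inE => /predU1P[->|/dS ->]; apply/eqP.
    rewrite (eq_quad (ind_addpt S u uS)) quad_addpt.
    have vu := neq_out u v uS vS; have uv : u != v by rewrite eq_sym.
    have := @dC_sum_le (ind S) u v vu.
    have -> : ind S v = 1 by rewrite /ind vS.
    have iu : ind S u = 0 by rewrite /ind (negPf uS).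
    move=> /(_ iu (fun=> ler0n _ _)).
    have [] := adj_jump uv Cuv; rewrite (dS v vS) du => -[];
    by rewrite /(dC u u) cartan_diag; lia.
  by move/maxS/(_ (subsetUr _ _)) => e; move: uS; rewrite -e !inE eqxx.
(* The coefficient is 1 if [d u >= 2 d v] and 2 if [d v >= 2 d u]; in both cases the norm drops by
   at least [4 d_i]. *)
have step u v (x : I -> int) : u \notin S -> v \in S -> C u v != 0 ->
    x u = 0 -> (forall k, 0 <= x k) -> x v = 2 ->
    exists2 c : int, 0 <= c &
      quad (fun k => x k + c * (k == u)%:R) <= quad x - 4 * (d i)%:Z.
  move=> uS vS Cuv xu x0 xv.
  have vu := neq_out u v uS vS; have uv : u != v by rewrite eq_sym.
  have := @dC_sum_le x u v vu xu x0; rewrite xv => le.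
  have du := boundary u v uS vS Cuv.
  have [] := adj_jump uv Cuv; rewrite (dS v vS) => -[] h1 h2.
  - by rewrite h1 eqxx in du.
  - by exists 1 => //; rewrite quad_addpt /(dC u u) cartan_diag; lia.
  - by exists 2 => //; rewrite quad_addpt /(dC u u) cartan_diag; lia.
have jS : j \notin S by apply: contra dji => /dS ->.
move=> u v uS vS Cuv; apply/eqP; apply: contraT => uj.
pose x0 k := 2 * ind S k.
have x0S k : k \in S -> x0 k = 2 by rewrite /x0 /ind => ->.
have x0N k : k \notin S -> x0 k = 0 by rewrite /x0 /ind => /negPf ->.
have x0ge k : 0 <= x0 k by rewrite /x0 mulr_ge0 // ler0n.
have [c c0 q1] := step j i x0 jS iS Cji (x0N _ jS) x0ge (x0S _ iS).
pose x1 k := x0 k + c * (k == j)%:R.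
have x1S k : k \in S -> x1 k = 2.
  by move=> kS; rewrite /x1 x0S // (negPf (neq_out j k jS kS)) mulr0 addr0.
have x1u : x1 u = 0 by rewrite /x1 x0N // (negPf uj) mulr0.
have x1ge k : 0 <= x1 k by rewrite /x1 addr_ge0 // mulr_ge0 // ler0n.
have [c' _ q2] := step u v x1 uS vS Cuv x1u x1ge (x1S _ vS).
(* The start [x0] has norm at most [4 * 2 d_i], and the two steps remove [4 d_i] each, so this norm
   is also nonpositive. *)
have : 0 < quad (fun k => x1 k + c' * (k == u)%:R).
  by apply: (@quad_gt0 _ i); rewrite x1S // (negPf (neq_out u i uS iS)) mulr0.
rewrite quadZ -[quad (fun=> _ + _)]/(quad x1) in q1.
move=> q3; have := lt_le_trans q3 q2.
move: (quad x1) (quad (ind S)) q1 qS => a b; lia.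
Qed.

(* At a multiple edge i => j the two nodes have different d; by unique_jump there
   is no other change of d in the diagram, so d takes only the values d i < d j,
   and the value 1 is attained. *)
Let multiple_edge i j : i != j -> C i j < -1 -> d i = 1%N.
Proof.
move=> ij Cij; have ji : j != i by rewrite eq_sym.
have [h2 h3 h4] : [/\ - 4 < C i j, C j i = -1 & (d j)%:Z = - C i j * (d i)%:Z].
  by case: (cartan_cases_sym ij) => [[]|[]|[]|[]]; lia || split.
have := symmetrizer_gt0 i => di.
have dij : d i != d j by nia.
have dji : d j != d i by rewrite eq_sym.
have [S [iS dS nS]] : exists S : {set I}, [/\ i \in S, forall v, v \in S -> d v = d i &
    forall u v, u \notin S -> v \in S -> C u v != 0 -> u = j].
  by apply: unique_jump => //; lia.
have [S' [jS' dS' nS']] : exists S : {set I}, [/\ j \in S, forall v, v \in S -> d v = d j &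
    forall u v, u \notin S -> v \in S -> C u v != 0 -> u = i].
  by apply: unique_jump => //; lia.
case: cartan => _ _ [_ [k dk] _] conn _.
(* An edge leaving the union would have to end at [j] or at [i], and both lie inside. Connectedness
   excludes a proper union. *)
have USS : S :|: S' = setT.
  apply/eqP/contraT => nT; have ne : S :|: S' != set0.
    by apply/set0Pn; exists i; rewrite inE iS.
  have [v [u [vSS uSS Cvu]]] := conn _ ne nT.
  have Cuv : C u v != 0 by apply: contra Cvu => /eqP/cartan_eq0 ->.
  move: uSS; rewrite inE negb_or => /andP[uS uS'].
  move: vSS; rewrite inE => /orP[vS|vS'].
    by rewrite (nS u v uS vS Cuv) jS' in uS'.
  by rewrite (nS' u v uS' vS' Cuv) iS in uS.
(* Since [d j >= 2], a node with symmetrizer 1 must lie in [S], where [d] equals [d i]. *)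
have : k \in S :|: S' by rewrite USS.
by rewrite inE => /orP[/dS|/dS']; lia.
Qed.

Variant rank2_spec i j : Prop :=
  | Rank2A1A1 of C i j = 0 & C j i = 0
  | Rank2A2 of C i j = -1 & C j i = -1 & d i = d j
  | Rank2B2 of C i j = -2 & C j i = -1 & d i = 1%N & d j = 2%N
  | Rank2C2 of C i j = -1 & C j i = -2 & d i = 2%N & d j = 1%N
  | Rank2G2 of C i j = -3 & C j i = -1 & d i = 1%N & d j = 3%N
  | Rank2G2' of C i j = -1 & C j i = -3 & d i = 3%N & d j = 1%N.

Lemma rank2P i j : i != j -> rank2_spec i j.
Proof.
move=> ij; have ji : j != i by rewrite eq_sym.
case: (cartan_cases_sym ij) => [[]|[]|[e h1 h2 h3]|[h1 h2 e h3]].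
- exact: Rank2A1A1.
- exact: Rank2A2.
- have dj := multiple_edge ji h1; rewrite dj in h3.
  have [e'|e'] : C j i = -2 \/ C j i = -3 by lia.
    by apply: Rank2C2 => //; lia.
  by apply: Rank2G2' => //; lia.
- have di := multiple_edge ij h1; rewrite di in h3.
  have [e'|e'] : C i j = -2 \/ C i j = -3 by lia.
    by apply: Rank2B2 => //; lia.
  by apply: Rank2G2 => //; lia.
Qed.

End CartanDatum.

(** * The action of [T'_i] on the monomial lattice *)

Lemma sh0 q a : sh q a 0 = a.
Proof. by apply: val_inj; rewrite /= expr0z mulr1. Qed.

Lemma shD q a k l : sh q (sh q a k) l = sh q a (k + l).
Proof.
by apply: val_inj; rewrite /= expfzDr ?mulrA //; case: (q).
Qed.

Section BraidAction.
Variables (I : finType) (C : I -> I -> int) (d : I -> nat) (q : Cx).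
Hypothesis cartan : simple_cartan_datum C d.

Local Notation V := {freeg (Kp I) / int}.
Local Notation T i := (fg_hom (Tp_gen C d q i)).
Local Notation dz i := ((d i)%:Z).
Implicit Types (i j k : I) (a b : Cx).

Definition sroot i : V := \sum_j C j i *: omega j.

Lemma wt_fund j : wt (fund j) = omega j.
Proof.
rewrite /wt (bigD1 j) //= /fund eqxx scale1r big1 ?addr0 // => k kj.
by rewrite eq_sym (negPf kj) scale0r.
Qed.

Lemma wt_sref i r : wt (sref C i r) = wt r - r i *: sroot i.
Proof.
rewrite /wt /sroot scaler_sumr -sumrB; apply: eq_bigr => j _.
by rewrite scalerBl scalerA.
Qed.

Lemma Tp_omega i : T i (omega i) = omega i - sroot i.
Proof. by rewrite fg_homU /= wt_sref wt_fund /fund eqxx scale1r. Qed.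

Lemma Tp_omega_neq i j : j != i -> T i (omega j) = omega j.
Proof.
by move=> /negPf ji; rewrite fg_homU /= wt_sref wt_fund /fund ji scale0r subr0.
Qed.

Lemma Tp_sroot i j : T i (sroot j) = sroot j - C i j *: sroot i.
Proof.
rewrite {1 2}/sroot raddf_sum /= (bigD1 i) //= [in RHS](bigD1 i) //=.
rewrite (additive_scale_int (T i)) /= Tp_omega scalerBr addrAC; congr (_ + _ - _).
by apply: eq_bigr => k ki; rewrite (additive_scale_int (T i)) /= Tp_omega_neq.
Qed.

(** Contribution of node [j] to the image of [Psi i a]: one term per node instead of three filtered
    sums, so that a single neighbour can be split off. *)
Definition edge i j a : V :=
  if C i j == -1 then Psi j (sh q a (dz i))
  else if C i j == -2 then Psi j a + Psi j (sh q a 2)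
  else if C i j == -3
  then Psi j (sh q a (-1)) + Psi j (sh q a 1) + Psi j (sh q a 3) else 0.

Lemma edge_diag i a : edge i i a = 0.
Proof. by rewrite /edge (cartan_diag cartan). Qed.

Lemma Tp_Psi i a :
  T i (Psi i a) = - Psi i (sh q a (2 * dz i)) + \sum_j edge i j a.
Proof.
rewrite fg_homU /= eqxx -!addrA; congr (_ + _).
rewrite big_mkcond [X in _ + (X + _)]big_mkcond [X in _ + (_ + X)]big_mkcond.
rewrite -!big_split; apply: eq_bigr => j _ /=; rewrite /edge.
case: (C i j =P -1) => [->|_]; first by rewrite /= !addr0.
by case: (C i j =P -2) => [->|_]; rewrite /= ?addr0 !add0r.
Qed.

Lemma Tp_Psi_neq i j a : j != i -> T i (Psi j a) = Psi j a.
Proof. by move=> /negPf ji; rewrite fg_homU /= ji. Qed.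

Lemma Tp_edge_neq i j k a : k != j -> T j (edge i k a) = edge i k a.
Proof.
move=> kj; rewrite /edge; case: ifP => _; first exact: Tp_Psi_neq.
case: ifP => _; first by rewrite raddfD /= !Tp_Psi_neq.
by case: ifP => _; rewrite ?raddf0 // !raddfD /= !Tp_Psi_neq.
Qed.

(* Playing the role of [- sroot i], with the spectral parameter [a]. *)
Definition Psi_incr i a : V := T i (Psi i a) - Psi i a.

Lemma Tp_PsiE i a : T i (Psi i a) = Psi i a + Psi_incr i a.
Proof. by rewrite /Psi_incr addrC subrK. Qed.

Lemma Psi_incrE i a : Psi_incr i a =
  - Psi i (sh q a (2 * dz i)) - Psi i a + \sum_(j | j != i) edge i j a.
Proof.
by rewrite /Psi_incr Tp_Psi (bigD1 i) //= edge_diag add0r addrAC.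
Qed.

Lemma Tp_sum_edge i a :
  T i (\sum_(j | j != i) edge i j a) = \sum_(j | j != i) edge i j a.
Proof. by rewrite raddf_sum; apply: eq_bigr => j ji /=; rewrite Tp_edge_neq. Qed.

(** The neighbour terms are fixed, so applying [T i] to the expansion adds [- Psi_incr i (sh q a (2
    * dz i)) - Psi_incr i a], whose last term cancels the original. *)
Lemma Tp_incr i a : T i (Psi_incr i a) = - Psi_incr i (sh q a (2 * dz i)).
Proof.
rewrite {1}Psi_incrE raddfD raddfB raddfN /= Tp_sum_edge !Tp_PsiE (Psi_incrE i a).
by abelian.
Qed.

Lemma Tp_incr_neq i j a : i != j ->
  T j (Psi_incr i a) = Psi_incr i a + (T j (edge i j a) - edge i j a).
Proof.
move=> ij; have ji : j != i by rewrite eq_sym.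
rewrite Psi_incrE (bigD1 j) //= raddfD raddfB raddfN raddfD raddf_sum /=.
rewrite !(Tp_Psi_neq _ ij).
rewrite (eq_bigr (fun k => edge i k a)) => [|k /andP[_ kj]]; last first.
  exact: Tp_edge_neq.
by abelian.
Qed.

Lemma braid_m_sym i j : braid_m C i j = braid_m C j i.
Proof. by rewrite /braid_m mulrC. Qed.

(** * Action of one node on the increments and roots of another *)

Section Pair.
Variables i j : I.
Hypothesis ij : i != j.

Lemma Tp_incr_edge0 a : C i j = 0 -> T j (Psi_incr i a) = Psi_incr i a.
Proof. by move=> e; rewrite Tp_incr_neq // /edge e /= raddf0 subrr addr0. Qed.

Lemma Tp_incr_edge1 a : C i j = -1 ->
  T j (Psi_incr i a) = Psi_incr i a + Psi_incr j (sh q a (dz i)).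
Proof. by move=> e; rewrite Tp_incr_neq // /edge e. Qed.

Lemma Tp_incr_edge2 a : C i j = -2 ->
  T j (Psi_incr i a) = Psi_incr i a + (Psi_incr j a + Psi_incr j (sh q a 2)).
Proof.
by move=> e; rewrite Tp_incr_neq // /edge e /= raddfD /= /Psi_incr; abelian.
Qed.

Lemma Tp_incr_edge3 a : C i j = -3 ->
  T j (Psi_incr i a) = Psi_incr i a +
    (Psi_incr j (sh q a (-1)) + Psi_incr j (sh q a 1) + Psi_incr j (sh q a 3)).
Proof.
move=> e; rewrite Tp_incr_neq // /edge e /= !raddfD /= /Psi_incr.
by abelian.
Qed.

End Pair.

Lemma Tp_opp_sroot i j n : C i j = - n%:Z ->
  T i (- sroot j) = - sroot j + (- sroot i) *+ n.
Proof.
move=> e; rewrite raddfN /= Tp_sroot e opprB scaleNr -[n%:Z]natz scaler_nat.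
by rewrite mulNrn addrC.
Qed.

Lemma Tp_opp_sroot_self i : T i (- sroot i) = - - sroot i.
Proof.
rewrite raddfN /= Tp_sroot (cartan_diag cartan); congr (- _).
by rewrite (_ : 2 = 1 + 1) // scalerDl scale1r opprD addrA subrr add0r.
Qed.

Lemma Tp_omegaE i : T i (omega i) = omega i + - sroot i.
Proof. exact: Tp_omega. Qed.

(** * Braid relations on generators and on the lattice *)

Lemma braid_generators i j (x : Kp I) : i != j -> (d i <= d j)%N ->
  alt_word (fun i => T i) i j (braid_m C i j) << x >> =
  alt_word (fun i => T i) j i (braid_m C i j) << x >>.
Proof.
move=> ij dij; have ji : j != i by rewrite eq_sym.
have PsiE k b : T k (Psi k b) = Psi k b + Psi_incr k (sh q b 0).
  by rewrite Tp_PsiE sh0.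
have self k b l : T k (Psi_incr k (sh q b l)) = - Psi_incr k (sh q b (l + 2 * dz k)).
  by rewrite Tp_incr shD.
(* Roots carry no spectral parameter; as a constant family they meet the hypotheses of the same
   braid lemmas, whatever the shifts. *)
pose X k (l : int) : V := - sroot k.
have Xself k l : T k (X k l) = - X k l by apply: Tp_opp_sroot_self.
have OmE k : T k (omega k) = omega k + X k 0 := Tp_omegaE k.
have OmN k l : l != k -> T k (omega l) = omega l := @Tp_omega_neq k l.
have PsiN k l b : l != k -> T k (Psi l b) = Psi l b := @Tp_Psi_neq k l b.
have fixed v : T i v = v -> T j v = v ->
    alt_word (fun i => T i) i j (braid_m C i j) v =
    alt_word (fun i => T i) j i (braid_m C i j) v.
  by move=> iv jv; rewrite !alt_word_fix.
have key k : [\/ k = i, k = j | k != i /\ k != j].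
  have [->|ki] := eqVneq k i; first exact: Or31.
  by have [->|kj] := eqVneq k j; [exact: Or32|exact: Or33].
have [[k [b [-> ki kj]]]|[k [-> ki kj]]|{fixed}] : [\/ exists k b, [/\ x = inl (k, b), k != i & k != j],
   exists k, [/\ x = inr k, k != i & k != j] |
   (exists b, x = inl (i, b)) \/ (exists b, x = inl (j, b)) \/ x = inr i \/ x = inr j].
- case: x => [[k b]|k]; case: (key k) => [->|->|[ki kj]].
  + by apply: Or33; left; exists b.
  + by apply: Or33; right; left; exists b.
  + by apply: Or31; exists k, b.
  + by apply: Or33; do 2!right; left.
  + by apply: Or33; do 3!right.
  + by apply: Or32; exists k.
- by apply: fixed; apply: PsiN.
- by apply: fixed; apply: OmN.
(* The orientations with [d i > d j] contradict [dij], leaving one case for each braid length. *)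
case: (rank2P cartan ij) => [e1 e2|e1 e2 e3|e1 e2 e3 e4|? ? e3 e4|e1 e2 e3 e4|? ? e3 e4];
  try (by exfalso; move: dij; rewrite e3 e4).
- rewrite (_ : braid_m C i j = 2%N) /=; last by rewrite /braid_m e1 e2.
  have Xi l : T j (X i l) = X i l by rewrite /X (@Tp_opp_sroot j i 0) // mulr0n addr0.
  have Xj l : T i (X j l) = X j l by rewrite /X (@Tp_opp_sroot i j 0) // mulr0n addr0.
  have Wi b := Tp_incr_edge0 ij b e1; have Wj b := Tp_incr_edge0 ji b e2.
  move=> [[b ->]|[[b ->]|[->|->]]].
  + by apply: (braid2 (Wi _) (PsiE _ _) (PsiN _ _ _ ij)).
  + by apply/esym/(braid2 (Wj _) (PsiE _ _) (PsiN _ _ _ ji)).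
  + by apply: (braid2 (Xi 0) (OmE _) (OmN _ _ ij)).
  + by apply/esym/(braid2 (Xj 0) (OmE _) (OmN _ _ ji)).
- rewrite (_ : braid_m C i j = 3%N) /=; last by rewrite /braid_m e1 e2.
  have Xi l : T j (X i l) = X i l + X j (l + dz i).
    exact: (@Tp_opp_sroot j i 1 e2).
  have Xj l : T i (X j l) = X j l + X i (l + dz i).
    exact: (@Tp_opp_sroot i j 1 e1).
  have Wi b l : T j (Psi_incr i (sh q b l)) =
    Psi_incr i (sh q b l) + Psi_incr j (sh q b (l + dz i)).
    by rewrite Tp_incr_edge1 // shD.
  have Wj b l : T i (Psi_incr j (sh q b l)) =
    Psi_incr j (sh q b l) + Psi_incr i (sh q b (l + dz i)).
    by rewrite Tp_incr_edge1 // shD e3.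
  have selfj b l : T j (Psi_incr j (sh q b l)) =
    - Psi_incr j (sh q b (l + 2 * dz i)) by rewrite self e3.
  move=> [[b ->]|[[b ->]|[->|->]]].
  + exact: (braid3 (self i b) (Wi b) (Wj b) (selfj b) (PsiE _ _) (PsiN _ _ _ ij)).
  + by apply/esym; exact: (braid3 (selfj b) (Wj b) (Wi b) (self i b) (PsiE _ _) (PsiN _ _ _ ji)).
  + exact: (@braid3 _ _ _ (X i) (X j) (dz i) _ (Xself i) Xi Xj (Xself j) (OmE _) (OmN _ _ ij)).
  + by apply/esym; exact: (@braid3 _ _ _ (X j) (X i) (dz i) _ (Xself j) Xj Xi (Xself i) (OmE _) (OmN _ _ ji)).
- rewrite (_ : braid_m C i j = 4%N) /=; last by rewrite /braid_m e1 e2.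
  (* The Cartan matrix acts transposed on roots: [T i] adds two root terms to [X j], whereas for
     increments it is [T j] that adds two terms. The weights therefore use the doubled lemmas with
     [i] and [j] exchanged; the same happens for length 6. *)
  have Xi l : T j (X i l) = X i l + X j (l + 2) := @Tp_opp_sroot j i 1 e2.
  have Xj l : T i (X j l) = X j l + (X i l + X i (l + 2)) := @Tp_opp_sroot i j 2 e1.
  have Wi b l : T j (Psi_incr i (sh q b l)) = Psi_incr i (sh q b l) +
      (Psi_incr j (sh q b l) + Psi_incr j (sh q b (l + 2))).
    by rewrite Tp_incr_edge2 // shD.
  have Wj b l : T i (Psi_incr j (sh q b l)) =
      Psi_incr j (sh q b l) + Psi_incr i (sh q b (l + 2)).
    by rewrite Tp_incr_edge1 // shD e4.
  have selfi b l : T i (Psi_incr i (sh q b l)) = - Psi_incr i (sh q b (l + 2)).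
    by rewrite self e3.
  have selfj b l : T j (Psi_incr j (sh q b l)) = - Psi_incr j (sh q b (l + 4)).
    by rewrite self e4.
  move=> [[b ->]|[[b ->]|[->|->]]].
  + exact: (braid4l (selfi b) (Wi b) (Wj b) (selfj b) (PsiE _ _) (PsiN _ _ _ ij)).
  + exact: (braid4r (selfi b) (Wi b) (Wj b) (selfj b) (PsiN _ _ _ ji) (PsiE _ _)).
  + by apply/esym; exact: (@braid4r _ _ _ (X j) (X i) (Xself j) Xj Xi (Xself i) _ (OmN _ _ ij) (OmE _)).
  + by apply/esym; exact: (@braid4l _ _ _ (X j) (X i) (Xself j) Xj Xi (Xself i) _ (OmE _) (OmN _ _ ji)).
- rewrite (_ : braid_m C i j = 6%N) /=; last by rewrite /braid_m e1 e2.
  have Xi l : T j (X i l) = X i l + X j (l + 3) := @Tp_opp_sroot j i 1 e2.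
  have Xj l : T i (X j l) = X j l + (X i (l - 1) + X i (l + 1) + X i (l + 3)).
    by rewrite /X (@Tp_opp_sroot i j 3) // !mulrS mulr0n addr0 addrA.
  have Wi b l : T j (Psi_incr i (sh q b l)) = Psi_incr i (sh q b l) +
      (Psi_incr j (sh q b (l - 1)) + Psi_incr j (sh q b (l + 1))
       + Psi_incr j (sh q b (l + 3))).
    by rewrite Tp_incr_edge3 // !shD.
  have Wj b l : T i (Psi_incr j (sh q b l)) =
      Psi_incr j (sh q b l) + Psi_incr i (sh q b (l + 3)).
    by rewrite Tp_incr_edge1 // shD e4.
  have selfi b l : T i (Psi_incr i (sh q b l)) = - Psi_incr i (sh q b (l + 2)).
    by rewrite self e3.
  have selfj b l : T j (Psi_incr j (sh q b l)) = - Psi_incr j (sh q b (l + 6)).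
    by rewrite self e4.
  move=> [[b ->]|[[b ->]|[->|->]]].
  + exact: (braid6l (selfi b) (Wi b) (Wj b) (selfj b) (PsiE _ _) (PsiN _ _ _ ij)).
  + exact: (braid6r (selfi b) (Wi b) (Wj b) (selfj b) (PsiN _ _ _ ji) (PsiE _ _)).
  + by apply/esym; exact: (@braid6r _ _ _ (X j) (X i) (Xself j) Xj Xi (Xself i) _ (OmN _ _ ij) (OmE _)).
  + by apply/esym; exact: (@braid6l _ _ _ (X j) (X i) (Xself j) Xj Xi (Xself i) _ (OmE _) (OmN _ _ ji)).
Qed.

Lemma braid_lattice i j : i != j ->
  alt_word (fun i => T i) i j (braid_m C i j) =1
  alt_word (fun i => T i) j i (braid_m C i j).
Proof.
move=> ij; apply: freeg_morph_ext => [||x].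
- exact: (alt_word_subr (fun i => T i : {additive V -> V})).
- exact: (alt_word_subr (fun i => T i : {additive V -> V})).
- have [dij|/ltnW dji] := leqP (d i) (d j); first exact: braid_generators.
  by rewrite braid_m_sym; apply/esym/braid_generators; rewrite // eq_sym.
Qed.

(** * Invertibility of [T'_i] *)

Lemma Tp_lattice_bij i : bijective (T i).
Proof.
(* The inverse comes from [Tp_incr]: [T i] sends the increment shifted back by [2 * dz i] to
   [- Psi_incr i a], which cancels the increment of [Psi i a]. On weights the reflection is its own
   inverse. *)
pose U := fg_hom (fun x : Kp I => match x with
  | inl (j, a) => if j == i then Psi i a + Psi_incr i (sh q a (- (2 * dz i)))
                  else Psi j a
  | inr j => T i (omega j) end).
have UPsi a : U (Psi i a) = Psi i a + Psi_incr i (sh q a (- (2 * dz i))).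
  by rewrite /U fg_homU eqxx.
have UPsi_neq j a : j != i -> U (Psi j a) = Psi j a.
  by move=> /negPf ji; rewrite /U fg_homU ji.
have Uomega j : U (omega j) = T i (omega j) by rewrite /U fg_homU.
have Uedge j a : j != i -> U (edge i j a) = edge i j a.
  move=> ji; rewrite /edge; case: ifP => _; first exact: UPsi_neq.
  case: ifP => _; first by rewrite /U raddfD /= -/U !UPsi_neq.
  case: ifP => _; last exact: (raddf0 U).
  by rewrite /U !raddfD /= -/U !UPsi_neq.
have Uincr a : U (Psi_incr i a) = - Psi_incr i (sh q a (- (2 * dz i))).
  rewrite {1}Psi_incrE /U raddfD raddfB raddfN raddf_sum /= -/U.
  rewrite (eq_bigr _ (fun j ji => Uedge j a ji)) !UPsi shD subrr sh0.
  by rewrite [X in - (_ + X)]Psi_incrE; abelian.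
have Tincr a : T i (Psi_incr i (sh q a (- (2 * dz i)))) = - Psi_incr i a.
  by rewrite Tp_incr shD addNr sh0.
have Tinvol j : T i (T i (omega j)) = omega j.
  have [->|ji] := eqVneq j i; last by rewrite !Tp_omega_neq.
  rewrite !Tp_omegaE raddfD /= Tp_opp_sroot_self Tp_omegaE opprK.
  by rewrite -addrA addNr addr0.
have Uwt r : U (wt r) = T i (wt r).
  rewrite /U !raddf_sum; apply: eq_bigr => j _ /=.
  by rewrite additive_scale_int (additive_scale_int (T i)) /= -/U Uomega.
exists U => [x|x].
- apply: (@freeg_morph_ext _ _ (U \o T i) id) => // [y z|[[j a]|j]] /=.
  + by rewrite /U !raddfB.
  + have [->|ji] := eqVneq j i; last by rewrite Tp_Psi_neq // UPsi_neq.
    by rewrite Tp_PsiE /U raddfD /= -/U UPsi Uincr addrK.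
  + by rewrite -[X in _ = X]Tinvol fg_homU Uwt.
- apply: (@freeg_morph_ext _ _ (T i \o U) id) => // [y z|[[j a]|j]] /=.
  + by rewrite /U !raddfB.
  + have [->|ji] := eqVneq j i; last by rewrite UPsi_neq // Tp_Psi_neq.
    by rewrite UPsi raddfD /= Tp_PsiE Tincr addrK.
  + by rewrite Uomega Tinvol.
Qed.

(** * Comparison with the Chari operators *)

Local Notation Tc' i := (fg_hom (Tc_gen C d q i)).
Local Notation emb' := (fg_hom (emb_gen d q)).

Definition Yedge i j a : {freeg (Ky I) / int} :=
  if C j i == -1 then Yv j a
  else if C j i == -2 then Yv j (sh q a (-1)) + Yv j (sh q a 1)
  else if C j i == -3
  then Yv j (sh q a (-2)) + Yv j a + Yv j (sh q a 2) else 0.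

Lemma AvarE i a : Avar C d q i a =
  Yv i (sh q a (- dz i)) + Yv i (sh q a (dz i)) - \sum_j Yedge i j a.
Proof.
rewrite /Avar; congr (_ - _).
rewrite big_mkcond [X in _ + X + _]big_mkcond [X in _ + X]big_mkcond.
rewrite -!big_split; apply: eq_bigr => j _ /=; rewrite /Yedge.
case: (C j i =P -1) => [->|_]; first by rewrite /= !addr0.
by case: (C j i =P -2) => [->|_]; rewrite /= ?addr0 !add0r.
Qed.

Lemma emb_Yv i a :
  emb' (Yv i a) = omega i + Psi i (sh q a (- dz i)) - Psi i (sh q a (dz i)).
Proof. by rewrite fg_homU. Qed.

(** If [C j i < -1], the images of the several [Y] factors telescope; if [C i j < -1], the two edges
    overlap and their common terms cancel. The shifts agree because [rank2P] fixes the values of [d]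
    at a multiple edge. *)
Lemma emb_Yedge i j a : j != i ->
  emb' (Yedge i j (sh q a (dz i))) =
  edge i j (sh q a (- dz i)) - edge i j (sh q a (dz i)) - C j i *: omega j.
Proof.
have scaleE n : C j i = - n%:Z -> C j i *: omega j = - omega j *+ n.
  by move=> ->; rewrite scaleNr -[n%:Z]natz scaler_nat mulNrn.
move=> ji; set W := _ *: _ in scaleE *; rewrite /Yedge /edge.
case: (rank2P cartan ji) => [e1 e2|e1 e2 e3|e1 e2 e3 e4|e1 e2 e3 e4|e1 e2 e3 e4|e1 e2 e3 e4].
- by rewrite (scaleE 0%N e1) e1 e2 /= raddf0 mulr0n !subr0.
- by rewrite (scaleE 1%N e1) e1 e2 /= emb_Yv !shD e3 subrr addNr; abelian.
- by rewrite (scaleE 2%N e1) e1 e2 /= raddfD /= !emb_Yv !shD e3 e4; abelian.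
- by rewrite (scaleE 1%N e1) e1 e2 /= emb_Yv !shD e3 e4; abelian.
- by rewrite (scaleE 3%N e1) e1 e2 /= !raddfD /= !emb_Yv !shD e3 e4; abelian.
- by rewrite (scaleE 1%N e1) e1 e2 /= emb_Yv !shD e3 e4; abelian.
Qed.

Lemma Tp_emb_generator i (x : Ky I) :
  T i (emb' << x >>) = emb' (Tc' i << x >>).
Proof.
case: x => j a; rewrite (fg_homU (Tc_gen C d q i)) -/(Yv j a) emb_Yv /=.
have [->|ji] := eqVneq j i; last first.
  by rewrite emb_Yv raddfB raddfD /= Tp_omega_neq // !Tp_Psi_neq.
rewrite /= AvarE !raddfB !raddfD /= raddf_sum /=.
rewrite (bigD1 i) //= {1}/Yedge (cartan_diag cartan) /= raddf0 add0r.
(* The edge differences match the neighbour terms of the two increments on the left, and the weights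
   match the off-diagonal part of [sroot i]; its diagonal part [2 omega i] comes from the two [Y]
   factors at node [i] in [Avar]. *)
rewrite (eq_bigr _ (fun j ji => emb_Yedge a ji)) !sumrB.
rewrite !emb_Yv Tp_omega !Tp_PsiE !Psi_incrE.
rewrite /sroot (bigD1 i) //= (cartan_diag cartan) !shD.
rewrite scaler_nat mulr2n (_ : - dz i + 2 * dz i = dz i); last by ring.
rewrite (_ : dz i + 2 * dz i = dz i + (dz i + dz i)); last by ring.
rewrite subrr addNr addr0 (_ : dz i + (- dz i - dz i) = - dz i); last by ring.
by abelian.
Qed.

Lemma Tp_emb i (y : Yr I) : Tp C d q i (emb d q y) = emb d q (Tc C d q i y).
Proof.
rewrite -[LHS]/((gr_map (T i) \o gr_map emb') y) gr_map_comp.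
rewrite -[RHS]/((gr_map emb' \o gr_map (Tc' i)) y) gr_map_comp.
apply: eq_gr_map y; apply: freeg_morph_ext => [u v|u v|x] /=.
- by rewrite !raddfB.
- by rewrite !raddfB.
- exact: Tp_emb_generator.
Qed.

End BraidAction.

(** * Passage from the monomial lattice to the group ring *)

Theorem mainTheorem3 (I : finType) (C : I -> I -> int) (d : I -> nat) (q : Cx) :
  simple_cartan_datum C d ->
  not_root_of_unity q ->
  (* (1) the T'_i are ring automorphisms of Y' satisfying the braid relations *)
  ((forall i : I, ring_automorphism (Tp C d q i)) /\
   (forall i j : I, i != j ->
      alt_word (Tp C d q) i j (braid_m C i j) =1 alt_word (Tp C d q) j i (braid_m C i j)))
  /\
  (* (2) T'_i restricted to Y (embedded in Y') is the Chari operator T_i *)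
  (forall (i : I) (y : Yr I), Tp C d q i (emb d q y) = emb d q (Tc C d q i y)).
Proof.
move=> cartan _; split; last exact: Tp_emb.
split=> [i|i j ij x]; first exact: (gr_map_automorphism (Tp_lattice_bij q cartan i)).
have word k l : alt_word (Tp C d q) k l (braid_m C i j) x =
    gr_map (alt_word (fun i => fg_hom (Tp_gen C d q i)) k l (braid_m C i j)) x.
  exact: alt_word_gr_map.
by rewrite !word (eq_gr_map (braid_lattice q cartan ij)).
Qed.
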